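(* Let $p\in(0,1)$, $q=1-p$, and for $N\ge1$ let $\{\xi_{i,j}(s):1\le i,j\le N,s\ge1\}$ be i.i.d. Bernoulli with $\mathbb P(\xi=1)=p$, $\mathbb P(\xi=0)=q$. Let $X(0)\in\mathbb R^N$ and $X_i(t+1)=\max_{1\le j\le N}\{X_j(t)+\xi_{i,j}(t+1)\}$, and let $v_N=\lim_{t\to\infty}t^{-1}\max_{i\le N}X_i(t)$ (this limit exists a.s. and is deterministic). Then, as $N\to\infty$, $$v_N=1-q^{N^2}2^N+o(q^{N^2}2^N).$$ *)

(* Defs.v *)
From HB Require Import structures.
From mathcomp Require Import all_boot all_order all_algebra.
From mathcomp Require Import all_classical all_reals all_analysis.
Set Implicit Arguments. Unset Strict Implicit. Unset Printing Implicit Defensive.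
Import Order.TTheory GRing.Theory Num.Theory.
Import numFieldNormedType.Exports.
Local Open Scope classical_set_scope.
Local Open Scope ring_scope.

(* Index k = (s, i, j) of the Bernoulli variable; time index s : nat in
   Rocq stands for the paper's time s+1 (paper's times start at 1). *)
Definition bidx (n : nat) := (nat * 'I_n.+1 * 'I_n.+1)%type.

Definition bernoulli_iid {d} {T : measurableType d} {R : realType}
  (P : probability T R) (n : nat) (p : R)
  (xi : nat -> 'I_n.+1 -> 'I_n.+1 -> T -> bool) : Prop :=
  (forall s i j, measurable [set w | xi s i j w]) /\
  (forall (S : seq (bidx n)) (b : bidx n -> bool), uniq S ->
     P [set w | forall k, k \in S -> xi k.1.1 k.1.2 k.2 w = b k]
     = (\prod_(k <- S) (if b k then p else 1 - p))%:E).

(* maximum over j in {0,...,n} (N = n+1 coordinates) *)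
Definition maxI {R : realType} (n : nat) (f : 'I_n.+1 -> R) : R :=
  \big[Num.max/f ord0]_(j < n.+1) f j.

Fixpoint proc {T : Type} {R : realType} (n : nat) (X0 : 'I_n.+1 -> R)
  (xi : nat -> 'I_n.+1 -> 'I_n.+1 -> T -> bool) (t : nat) (w : T)
  : 'I_n.+1 -> R :=
  match t with
  | 0 => X0
  | t'.+1 => fun i => maxI (fun j => proc X0 xi t' w j + (nat_of_bool (xi t' i j w))%:R)
  end.

(* Main.v *)
Require Import Defs.
From HB Require Import structures.
From mathcomp Require Import all_boot all_order all_algebra.
From mathcomp Require Import all_classical all_reals all_analysis.
From mathcomp Require Import measurable_realfun ring lra zify.
Import Order.TTheory GRing.Theory Num.Theory.
Import numFieldNormedType.Exports.
Local Open Scope ring_scope.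
Set Implicit Arguments.
Unset Strict Implicit.
Unset Printing Implicit Defensive.

(** A site is a leader when its value is the maximum M of the N values. From a
leader set of size z, each site independently sees a one in a leading column
with probability 1 - q^z. If some site does, M increases by one and these sites
are the new leaders; otherwise (a stall, of probability q^(N z)) M is unchanged
and every site becomes a leader. So the number of leaders Z is a Markov chain
and 1 - v_N is its asymptotic frequency of stalls, i.e. the Cesaro limit of
E q^(N Z_t).

One step of the chain started from z maps x^Z to (x + (1 - x) q^z)^N up to a
term accounting for stalls. Expanding the power at x = q^i gives a linear
recursion between the moments E q^(i Z_t), 0 <= i <= N. For the upper bound a
supersolution of this recursion, with a cut-off at i = floor (sqrt N), yields
E q^(N Z_t) <= q^(N^2) 2^N (1 + o(1)) for every t. For the lower bound, from any
number of leaders the expected value of q^(N Z) after one step is at least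
q^(N^2) (1 - q^N)^N (2^N - N - 1) when N is large. *)

(** * The chain of leader sets *)

Lemma bernoulli_lower (R : realDomainType) (x : R) m :
  0 <= x -> x <= 1 -> 1 - m%:R * x <= (1 - x) ^+ m.
Proof.
move=> x0 x1; elim: m => [|m IH]; first by rewrite mul0r subr0 expr0.
have nx0 : 0 <= 1 - x by rewrite subr_ge0.
rewrite exprS; apply: le_trans (ler_wpM2l nx0 IH).
rewrite -natr1; have := ler0n R m; move: (m%:R) => k k0.
by have := mulr_ge0 (mulr_ge0 k0 x0) x0; lra.
Qed.

Definition bmat (n : nat) := {ffun 'I_n.+1 -> {ffun 'I_n.+1 -> bool}}.

Definition hit {n : nat} (A : {set 'I_n.+1}) (c : bmat n) : {set 'I_n.+1} :=
  [set i | [exists j in A, c i j]].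

Definition nextlead {n : nat} (A : {set 'I_n.+1}) (c : bmat n) : {set 'I_n.+1} :=
  if hit A c == finset.set0 then [set: 'I_n.+1] else hit A c.

Definition bwt {R : nzRingType} (p : R) (b : bool) : R := if b then p else 1 - p.

Definition mwt {R : comNzRingType} (p : R) {n : nat} (c : bmat n) : R :=
  \prod_i \prod_j bwt p (c i j).

(** The law of the leader set after [t] steps, as a finite sum free of any probability space;
    [lead_cylinder] ties it to [xi]. All sites lead at time 0 because the process is first run from
    zero data. *)
Fixpoint leadlaw {R : comNzRingType} (p : R) {n : nat} (t : nat)
    (A : {set 'I_n.+1}) : R :=
  if t is t'.+1 then
    \sum_B \sum_(c : bmat n | nextlead B c == A) leadlaw p t' B * mwt p c
  else (A == [set: 'I_n.+1])%:R.

Definition leadE {R : comNzRingType} (p : R) {n : nat} (t : nat)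
    (f : {set 'I_n.+1} -> R) : R := \sum_A leadlaw p t A * f A.

Lemma sum_mwt_rows (R : comNzRingType) (p : R) (n : nat)
    (g : 'I_n.+1 -> {ffun 'I_n.+1 -> bool} -> R) :
  \sum_(c : bmat n) mwt p c * \prod_i g i (c i)
  = \prod_i \sum_(r : {ffun 'I_n.+1 -> bool}) (\prod_j bwt p (r j)) * g i r.
Proof.
rewrite bigA_distr_bigA /=; apply: eq_bigr => c _.
by rewrite /mwt -big_split.
Qed.

(** The indicator that a row misses [A] is a product over columns, so the sum factors: a column of
    [A] contributes [1 - p], any other contributes [1]. *)
Lemma sum_bwt (R : comNzRingType) (p : R) (I : finType) (A : {set I}) :
  \sum_(r : {ffun I -> bool}) (\prod_j bwt p (r j)) * ([forall j in A, ~~ r j])%:R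
  = (1 - p) ^+ #|A|.
Proof.
have E (r : {ffun I -> bool}) :
    ([forall j in A, ~~ r j])%:R = \prod_j (~~ ((j \in A) && r j))%:R :> R.
  have [/forallP H|/forallPn [j]] := boolP [forall j in A, ~~ r j].
    by rewrite big1 // => j _; move: (H j); case: (j \in A); case: (r j).
  rewrite negb_imply negbK => /andP[jA rj].
  by rewrite (bigD1 j) //= jA rj mul0r.
under eq_bigr => r _ do rewrite E -big_split /=.
rewrite -(bigA_distr_bigA (fun j b => bwt p b * (~~ ((j \in A) && b))%:R)) /=.
rewrite -prodr_const [RHS]big_mkcond /=; apply: eq_bigr => j _.
rewrite big_bool /=; case: (j \in A) => /=.
  by rewrite mulr0 mulr1 add0r.
by rewrite !mulr1 addrC subrK.
Qed.

Lemma sum_mwt (R : comNzRingType) (p : R) (n : nat) :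
  \sum_(c : bmat n) mwt p c = 1.
Proof.
under eq_bigr => c _ do rewrite -[mwt p c]mulr1.
transitivity (\sum_(c : bmat n) mwt p c * \prod_(i < n.+1) (1 : R)).
  by apply: eq_bigr => c _; rewrite big1_eq.
rewrite (sum_mwt_rows p (fun _ _ => 1)) big1 // => i _.
rewrite -[RHS](expr0 (1 - p)) -(@cards0 'I_n.+1) -sum_bwt.
apply: eq_bigr => r _; congr (_ * _).
have -> // : [forall j in (finset.set0 : {set 'I_n.+1}), ~~ r j].
by apply/forallP => j; rewrite inE.
Qed.

(* The rows of [c] are independent, and row [i] misses [A] with probability
   [(1 - p) ^ #|A|]. *)
Lemma sum_mwt_hit (R : comNzRingType) (p x : R) (n : nat) (A : {set 'I_n.+1}) :
  \sum_(c : bmat n) mwt p c * x ^+ #|hit A c|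
  = (x + (1 - x) * (1 - p) ^+ #|A|) ^+ n.+1.
Proof.
transitivity (\sum_(c : bmat n) mwt p c *
    \prod_i (fun r : {ffun 'I_n.+1 -> bool} =>
       x + (1 - x) * ([forall j in A, ~~ r j])%:R) (c i)).
  apply: eq_bigr => c _; congr (_ * _).
  rewrite -prodr_const big_mkcond /=; apply: eq_bigr => i _.
  rewrite inE; have -> : [forall j in A, ~~ c i j] = ~~ [exists j in A, c i j].
    by rewrite negb_exists; apply: eq_forallb => j; rewrite negb_and implybE.
  by case: [exists j in A, c i j] => /=; rewrite ?mulr0 ?mulr1 ?addr0 // addrC subrK.
rewrite (sum_mwt_rows p (fun _ r => x + (1 - x) * ([forall j in A, ~~ r j])%:R)).
rewrite prodr_const card_ord; congr (_ ^+ _).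
have S1 : \sum_(r : {ffun 'I_n.+1 -> bool}) \prod_j bwt p (r j) = 1.
  rewrite -(bigA_distr_bigA (fun _ b => bwt p b)) big1 // => j _.
  by rewrite big_bool /= addrC subrK.
under eq_bigr => r _ do rewrite mulrDr mulrCA.
by rewrite big_split /= -mulr_suml S1 mul1r -mulr_sumr sum_bwt.
Qed.

(** The Markov property: one step of the chain is moved from the law onto the test function. *)
Lemma leadES (R : comNzRingType) (p : R) (n t : nat) (f : {set 'I_n.+1} -> R) :
  leadE p t.+1 f = leadE p t (fun B => \sum_(c : bmat n) mwt p c * f (nextlead B c)).
Proof.
rewrite /leadE /=.
under eq_bigr => A _ do rewrite mulr_suml.
rewrite exchange_big /=; apply: eq_bigr => B _.
under eq_bigr => A _ do rewrite mulr_suml.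
rewrite (exchange_big_dep xpredT) //= mulr_sumr; apply: eq_bigr => c _.
by rewrite (big_pred1 (nextlead B c)) ?mulrA // => A; rewrite /= eq_sym.
Qed.

Lemma leadE0 (R : comNzRingType) (p : R) (n : nat) (f : {set 'I_n.+1} -> R) :
  leadE p 0 f = f [set: 'I_n.+1].
Proof.
rewrite /leadE (bigD1 [set: 'I_n.+1]) //= eqxx mul1r big1 ?addr0 // => A /negPf ->.
by rewrite mul0r.
Qed.

(* A stall, the event [hit B c = set0], is singled out by [x = 0] in
   [sum_mwt_hit]. *)
Lemma sum_mwt_next (R : comNzRingType) (p x : R) (n : nat) (A : {set 'I_n.+1}) :
  \sum_(c : bmat n) mwt p c * x ^+ #|nextlead A c|
  = (x + (1 - x) * (1 - p) ^+ #|A|) ^+ n.+1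
    - ((1 - p) ^+ #|A|) ^+ n.+1 * (1 - x ^+ n.+1).
Proof.
have -> : (1 - p) ^+ #|A| = 0 + (1 - 0) * (1 - p) ^+ #|A| by rewrite add0r subr0 mul1r.
rewrite -(sum_mwt_hit p 0 A) add0r subr0 mul1r -sum_mwt_hit mulr_suml -sumrB.
apply: eq_bigr => c _; rewrite /nextlead; case: eqVneq => [->|N0].
  by rewrite cardsT card_ord cards0 !expr0 !mulr1 mulrBr mulr1 subKr.
by rewrite expr0n cards_eq0 (negPf N0) mulr0 mul0r subr0.
Qed.

(** * Moments of the number of leaders and their one-step inequalities *)

Section order.
Variables (R : realFieldType) (p : R).
Hypotheses (p0 : 0 <= p) (p1 : p <= 1).

Lemma mwt_ge0 n (c : bmat n) : 0 <= mwt p c.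
Proof.
apply: prodr_ge0 => i _; apply: prodr_ge0 => j _.
by rewrite /bwt; case: ifP => // _; rewrite subr_ge0.
Qed.

Lemma leadlaw_ge0 n t (A : {set 'I_n.+1}) : 0 <= leadlaw p t A.
Proof.
elim: t A => [|t IH] A /=; first by rewrite ler0n.
by apply: sumr_ge0 => B _; apply: sumr_ge0 => c _; rewrite mulr_ge0 ?IH ?mwt_ge0.
Qed.

(** A stall resets the leaders to all sites, so the empty set is never reached. Hence [leadE_le]
    compares only on nonempty [A], where [(1 - p) ^+ #|A| <= 1 - p]. *)
Lemma leadlaw_set0 n t : leadlaw p t (finset.set0 : {set 'I_n.+1}) = 0.
Proof.
have T0 : ([set: 'I_n.+1] == finset.set0) = false.
  by rewrite -cards_eq0 cardsT card_ord.
case: t => [|t] /=; first by rewrite eq_sym T0.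
rewrite big1 // => B _; rewrite big1 // => c.
by rewrite /nextlead; case: ifP => [|->//]; rewrite T0.
Qed.

Lemma leadE_le n t (f g : {set 'I_n.+1} -> R) :
  (forall A, A != finset.set0 -> f A <= g A) -> leadE p t f <= leadE p t g.
Proof.
move=> fg; apply: ler_sum => A _.
have [->|A0] := eqVneq A finset.set0; first by rewrite leadlaw_set0 !mul0r.
by rewrite ler_wpM2l ?leadlaw_ge0 ?fg.
Qed.

Lemma leadE_cst n t a : leadE p t (fun _ : {set 'I_n.+1} => a) = a.
Proof.
elim: t => [|t IH]; first exact: leadE0.
rewrite leadES -[RHS]IH; apply: eq_bigr => A _; congr (_ * _).
by rewrite -mulr_suml sum_mwt mul1r.
Qed.

Lemma leadE_sum n t (I : Type) (r : seq I) (a : I -> R)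
    (f : I -> {set 'I_n.+1} -> R) :
  leadE p t (fun A => \sum_(i <- r) a i * f i A) = \sum_(i <- r) a i * leadE p t (f i).
Proof.
rewrite /leadE; under eq_bigr => A _ do rewrite mulr_sumr.
rewrite exchange_big /=; apply: eq_bigr => i _.
by rewrite mulr_sumr; apply: eq_bigr => A _; rewrite mulrCA.
Qed.

(** The generating function of the number of leaders at [(1 - p) ^+ i]; for [i = n.+1] it is the
    probability of a stall at time [t]. *)
Definition leadpgf n t i := leadE p t (fun A : {set 'I_n.+1} => (1 - p) ^+ (i * #|A|)%N).

Let q0 : 0 <= 1 - p. Proof. by rewrite subr_ge0. Qed.
Let q1 : 1 - p <= 1. Proof. by rewrite lerBlDr lerDl. Qed.

(* The coefficient of [y ^ N] in [sum_mwt_next] is [(1 - x)^N - 1 + x^N <= 0]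
   and may be dropped. *)
Lemma leadpgfS_le n t i :
  leadpgf n t.+1 i
  <= \sum_(0 <= j < n.+1) 'C(n.+1, j)%:R * (1 - p) ^+ (i * (n.+1 - j))%N * leadpgf n t j.
Proof.
rewrite /leadpgf leadES -leadE_sum; apply: leadE_le => A _.
under eq_bigr => c _ do rewrite exprM.
rewrite sum_mwt_next; set x := (1 - p) ^+ i; set y := (1 - p) ^+ #|A|.
have x0 : 0 <= x by exact: exprn_ge0.
have x1 : x <= 1 by exact: exprn_ile1.
have y0 : 0 <= y by exact: exprn_ge0.
rewrite exprDn big_ord_recr /= -[X in _ <= X]addr0 big_mkord -addrA lerD //.
  apply: ler_sum => j _.
  rewrite exprM -/x mulnC exprM -/y exprMn -mulr_natl -!mulrA ler_wpM2l // ?ler0n //.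
  rewrite ler_wpM2l ?exprn_ge0 // ler_piMl ?exprn_ge0 //.
  by rewrite exprn_ile1 ?subr_ge0 // lerBlDr lerDl.
rewrite subnn expr0 mul1r binn mulr1n exprMn mulrC -mulrBr.
rewrite mulr_ge0_le0 ?exprn_ge0 // opprB addrA subr_le0 -lerBrDr.
rewrite exprS (le_trans (ler_piMr _ (exprn_ile1 _ _ _))) ?subr_ge0 //.
  by rewrite lerBlDr lerDl.
by rewrite lerB // exprS ler_piMr // exprn_ile1.
Qed.

(* Only the terms [j < N - 1] are kept: the last two combine to
   [y ^ (N - 1) * (N x (1 - x)^(N - 1) - (1 - (1 - x)^N - x^N) y)], which is
   nonnegative as soon as [y <= 1 - p <= (1 - x)^(N - 1)]. *)
Lemma leadpgfSS_ge n t (x := (1 - p) ^+ n.+1) :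
  1 - p <= (1 - x) ^+ n ->
  x ^+ n.+1 * (1 - x) ^+ n.+1 * (2 ^+ n.+1 - n.+2%:R) <= leadpgf n t.+1 n.+1.
Proof.
move=> hx; rewrite /leadpgf leadES -[X in X <= _](leadE_cst n t).
apply: leadE_le => A A0.
under eq_bigr => c _ do rewrite exprM.
rewrite sum_mwt_next -/x; set y := (1 - p) ^+ #|A|.
have x0 : 0 <= x by exact: exprn_ge0.
have x1 : x <= 1 by exact: exprn_ile1.
have y0 : 0 <= y by exact: exprn_ge0.
have yx : x <= y by apply: ler_wiXn2l => //; rewrite -[leqRHS](card_ord n.+1) max_card.
have yq : y <= 1 - p.
  by rewrite -[leRHS]expr1 ler_wiXn2l // lt0n cards_eq0.
have nx0 : 0 <= 1 - x by rewrite subr_ge0.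
have nx1 : 1 - x <= 1 by rewrite lerBlDr lerDl.
rewrite [(x + _) ^+ _]exprDn big_ord_recr big_ord_recr /=.
rewrite subnn subSnn expr0 mul1r binn mulr1n binSn -addrA -addrA.
have S2 : 2 ^+ n.+1 - n.+2%:R = \sum_(j < n) 'C(n.+1, j)%:R :> R.
  rewrite -[2]/(1 + 1 : R) exprDn big_ord_recr big_ord_recr /= binn binSn.
  under eq_bigr => j _ do rewrite !expr1n mulr1.
  by rewrite !expr1n !mulr1 mulr1n -[n.+2%:R]natr1 -addrA addrK.
(* Termwise for [j < n]: [y >= x] gives [y ^+ j >= x ^+ j], and
   [(1 - x) ^+ j >= (1 - x) ^+ n.+1]. *)
rewrite S2 -[leLHS]addr0 lerD //.
  rewrite mulr_sumr; apply: ler_sum => j _.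
  rewrite mulr_natr lerMn2r; apply/orP; right.
  have jn : (j <= n.+1)%N by exact: leq_trans (ltnW (ltn_ord j)) (leqnSn n).
  have -> : x ^+ n.+1 = x ^+ (n.+1 - j) * x ^+ j by rewrite -exprD subnK.
  rewrite -mulrA ler_wpM2l ?exprn_ge0 // exprMn mulrC.
  by rewrite ler_pM ?exprn_ge0 ?lerXn2r ?nnegrE // ler_wiXn2l.
have -> : x ^+ 1 * ((1 - x) * y) ^+ n *+ n.+1 +
    ((1 - x) * y) ^+ n.+1 - y ^+ n.+1 * (1 - x ^+ n.+1)
  = y ^+ n * (n.+1%:R * x * (1 - x) ^+ n - y * (1 - x ^+ n.+1 - (1 - x) ^+ n.+1)).
  rewrite expr1 -mulr_natl !exprMn !exprS.
  by move: (x ^+ n) (y ^+ n) ((1 - x) ^+ n) (n.+1%:R) => a b c k; ring.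
rewrite mulr_ge0 ?exprn_ge0 // subr_ge0.
have B : 1 - x ^+ n.+1 - (1 - x) ^+ n.+1 <= n.+1%:R * x.
  have := bernoulli_lower n.+1 x0 x1.
  by have := exprn_ge0 n.+1 x0; lra.
apply: le_trans (_ : y * (n.+1%:R * x) <= _); first by rewrite ler_wpM2l.
by rewrite mulrC ler_wpM2l ?mulr_ge0 ?ler0n // (le_trans yq).
Qed.

End order.

Local Open Scope classical_set_scope.

(** * Supersolution of the moment recursion *)

Lemma leq_bin_exp n k : ('C(n, k) <= n ^ k)%N.
Proof.
apply: leq_trans (_ : n ^_ k <= _)%N; first by rewrite -bin_ffact leq_pmulr ?fact_gt0.
elim: k => [|k IH]; first by rewrite ffactn0.
by rewrite ffactnSr expnSr leq_mul ?leq_subr.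
Qed.

Lemma leq_sum_bin_exp n s : (1 < n)%N -> (\sum_(1 <= k < s) 'C(n, k) <= n ^ s)%N.
Proof.
move=> n1; elim: s => [|s IH]; first by rewrite big_geq.
have [->|s0] := posnP s; first by rewrite big_geq.
rewrite big_nat_recr //= (leq_trans (leq_add IH (leq_bin_exp n s))) //.
by rewrite addnn -mul2n expnS leq_mul.
Qed.

Section supersolution.
Variables (R : realFieldType) (q : R) (N s : nat).
Hypotheses (q0 : 0 <= q) (q1 : q <= 1).

(* [supU j] will bound [E (q ^ (j Z)) / q ^ (j N)], where [Z] is the number of
   leaders. The recursion of [leadpgfS_le] for these quantities has kernel
   ['C(N, k) * q ^ (k (N - j))]; the terms [k < s] are fed the bound [supU k <= 2]
   and the terms [k >= s] the crude bound [2 * 2 ^ N] on their weighted sum. *)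
Definition supU (j : nat) : R :=
  1 + 2 * (\sum_(1 <= k < s) 'C(N, k)%:R * q ^+ (k * (N - j)))
    + 2 * 2 ^+ N * q ^+ (s * (N - j)).

(** The factor [1 + o(1)] of the upper bound; its three terms come from those of [supU]. *)
Definition supc : R :=
  1 + 2 * (N%:R ^+ s * ((1 + q) / 2) ^+ N) + 2 * ((1 + q ^+ s) ^+ N - 1).

Lemma sum_bin_exp (k : nat) :
  \sum_(0 <= j < N) 'C(N, j)%:R * q ^+ (k * (N - j)) = (1 + q ^+ k) ^+ N - 1.
Proof.
rewrite [1 + _]addrC exprDn big_ord_recr /= subnn expr0 expr1n mulr1 binn mulr1n addrK.
by rewrite big_mkord; apply: eq_bigr => j _; rewrite expr1n mulr1 exprM mulr_natl.
Qed.

(** After exchanging sums, [q ^+ (k * (N - j))] sums to [(1 + q ^+ k) ^+ N - 1], at most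
    [(1 + q) ^+ N] for [k >= 1]; the weights of these [k] total at most [N ^ s]. *)
Lemma sum_bin_supU : (1 < N)%N -> \sum_(0 <= j < N) 'C(N, j)%:R * supU j <= 2 ^+ N * supc.
Proof.
move=> N1.
have -> : \sum_(0 <= j < N) 'C(N, j)%:R * supU j =
    (2 ^+ N - 1) + 2 * (\sum_(1 <= k < s) 'C(N, k)%:R * ((1 + q ^+ k) ^+ N - 1))
    + 2 * 2 ^+ N * ((1 + q ^+ s) ^+ N - 1).
  rewrite -(sum_bin_exp s).
  have -> : 2 ^+ N - 1 = \sum_(0 <= j < N) 'C(N, j)%:R :> R.
    have := sum_bin_exp 0; rewrite expr0 -[1 + 1 : R]/2 => <-.
    by apply: eq_bigr => j _; rewrite ?mul0n ?expr0 ?mulr1.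
  have -> : \sum_(1 <= k < s) 'C(N, k)%:R * ((1 + q ^+ k) ^+ N - 1)
      = \sum_(0 <= j < N) 'C(N, j)%:R * \sum_(1 <= k < s) 'C(N, k)%:R * q ^+ (k * (N - j)).
    under eq_bigr => k _ do rewrite -sum_bin_exp mulr_sumr.
    rewrite exchange_big /=; apply: eq_bigr => j _.
    by rewrite mulr_sumr; apply: eq_bigr => k _; rewrite mulrCA.
  rewrite !mulr_sumr -!big_split /=; apply: eq_bigr => j _.
  by rewrite /supU; ring.
have -> : 2 ^+ N * supc
    = 2 ^+ N + 2 * (N%:R ^+ s * (1 + q) ^+ N) + 2 * 2 ^+ N * ((1 + q ^+ s) ^+ N - 1).
  by rewrite /supc expr_div_n; field; rewrite expf_neq0.
rewrite lerD2r; apply: lerD; first by rewrite gerBl.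
rewrite ler_wpM2l //.
apply: le_trans (_ : \sum_(1 <= k < s) 'C(N, k)%:R * (1 + q) ^+ N <= _).
  rewrite !big_nat; apply: ler_sum => k /andP[k1 _].
  rewrite ler_wpM2l ?ler0n // lerBlDr (le_trans (_ : _ <= (1 + q) ^+ N)) ?lerDl //.
  rewrite lerXn2r ?nnegrE ?addr_ge0 ?exprn_ge0 // lerD2l.
  by rewrite -[leRHS]expr1 ler_wiXn2l.
rewrite -mulr_suml ler_wpM2r ?exprn_ge0 ?addr_ge0 //.
by rewrite -natr_sum -natrX ler_nat leq_sum_bin_exp.
Qed.

Lemma supU_ge0 j : 0 <= supU j.
Proof.
rewrite /supU !addr_ge0 // ?mulr_ge0 ?exprn_ge0 //.
by rewrite sumr_ge0 // => k _; rewrite mulr_ge0 ?ler0n ?exprn_ge0.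
Qed.

Hypotheses (s0 : (0 < s)%N) (sN : (s <= N)%N) (N1 : (1 < N)%N).
Hypotheses (supU_head : forall j, (1 <= j < s)%N -> supU j <= 2) (supc2 : supc <= 2).

(** For [j >= s] the kernel is at most [q ^+ (s * (N - i))], and the remaining weighted sum is at
    most [2 ^+ N * supc <= 2 * 2 ^+ N], which is the last term of [supU i]. The leading [1] is the
    moment of index [0]. *)
Lemma supU_super i :
  1 + \sum_(1 <= j < N) 'C(N, j)%:R * q ^+ (j * (N - i)) * supU j <= supU i.
Proof.
rewrite (@big_cat_nat _ _ _ s) //= {3}/supU addrA lerD //.
  rewrite lerD2l mulr_sumr !big_nat; apply: ler_sum => k ks.
  by rewrite mulrC ler_wpM2r ?supU_head // mulr_ge0 ?ler0n ?exprn_ge0.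
apply: le_trans (_ : \sum_(s <= j < N) ('C(N, j)%:R * supU j) * q ^+ (s * (N - i)) <= _).
  rewrite !big_nat; apply: ler_sum => k /andP[sk _].
  rewrite mulrAC ler_wpM2l ?mulr_ge0 ?ler0n ?supU_ge0 //.
  by rewrite ler_wiXn2l // leq_mul.
rewrite -mulr_suml ler_wpM2r ?exprn_ge0 // mulrC.
apply: le_trans (ler_wpM2l (exprn_ge0 _ _) supc2) => //.
apply: le_trans (sum_bin_supU N1).
rewrite [leRHS](@big_cat_nat _ _ _ s) //= lerDr.
by rewrite sumr_ge0 // => k _; rewrite mulr_ge0 ?ler0n ?supU_ge0.
Qed.

Variable G : nat -> nat -> R.
Hypotheses (G_0 : forall t, G t 0 = 1) (G0_ : forall i, G 0 i = q ^+ (i * N)).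
Hypothesis GS : forall t i,
  G t.+1 i <= \sum_(0 <= j < N) 'C(N, j)%:R * q ^+ (i * (N - j)) * G t j.

Let GS' t i : (i <= N)%N ->
  (forall j, (1 <= j < N)%N -> G t j <= q ^+ (j * N) * supU j) ->
  G t.+1 i <= q ^+ (i * N) * (1 + \sum_(1 <= j < N) 'C(N, j)%:R * q ^+ (j * (N - i)) * supU j).
Proof.
move=> iN H; apply: le_trans (GS t i) _.
rewrite big_ltn ?(ltnW N1) // bin0 mul1r subn0 G_0 mulr1 mulrDr mulr1 lerD2l.
rewrite mulr_sumr !big_nat; apply: ler_sum => j jN.
apply: le_trans (ler_wpM2l _ (H j jN)) _.
  by rewrite mulr_ge0 ?ler0n ?exprn_ge0.
rewrite !mulrA ler_wpM2r ?supU_ge0 // -[leLHS]mulrA -exprD [leRHS]mulrAC -exprD [leRHS]mulrC.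
(* The rescaling rests on [i (N - j) + j N = i N + j (N - i)], valid for truncated subtraction since
   [i, j <= N]. *)
by rewrite le_eqVlt; apply/orP; left; apply/eqP; congr (_ * q ^+ _); nia.
Qed.

(** The supersolution controls the moments [1 <= j < N] only: [supU N] exceeds [2 * 2 ^+ N], too
    large for the sharp constant. One more use of the recursion at [i = N], where the kernel is the
    bare binomial, gives [2 ^+ N * supc]. *)
Lemma supersolution_bound t : G t N <= q ^+ (N * N) * (2 ^+ N * supc).
Proof.
have H u j : (1 <= j < N)%N -> G u j <= q ^+ (j * N) * supU j.
  elim: u j => [|u IH] j jN.
    rewrite G0_ ler_peMr ?exprn_ge0 // /supU -addrA lerDl addr_ge0 // ?mulr_ge0 ?exprn_ge0 //.
    by rewrite sumr_ge0 // => k _; rewrite mulr_ge0 ?ler0n ?exprn_ge0.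
  have jN' : (j <= N)%N by case/andP: jN => _ /ltnW.
  apply: le_trans (GS' jN' (IH)) _.
  by rewrite ler_wpM2l ?exprn_ge0 ?supU_super.
have c1 : 1 <= 2 ^+ N * supc.
  apply: le_trans (sum_bin_supU N1); rewrite big_ltn ?(ltnW N1) // bin0 mul1r.
  rewrite /supU -!addrA lerDl !addr_ge0 // ?mulr_ge0 ?exprn_ge0 //.
    by rewrite sumr_ge0 // => k _; rewrite mulr_ge0 ?ler0n ?exprn_ge0.
  by rewrite sumr_ge0 // => k _; rewrite mulr_ge0 ?ler0n ?supU_ge0.
case: t => [|t]; first by rewrite G0_ ler_peMr ?exprn_ge0.
apply: le_trans (GS' (leqnn N) (H t)) _; rewrite ler_wpM2l ?exprn_ge0 //.
apply: le_trans (sum_bin_supU N1); rewrite [leRHS]big_ltn ?(ltnW N1) // bin0 mul1r lerD //.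
  rewrite /supU -addrA lerDl addr_ge0 // ?mulr_ge0 ?exprn_ge0 //.
  by rewrite sumr_ge0 // => k _; rewrite mulr_ge0 ?ler0n ?exprn_ge0.
by apply: ler_sum => j _; rewrite subnn muln0 expr0 mulr1.
Qed.

End supersolution.

(** * Asymptotics with the cut-off at the integer square root of [N] *)

Section asymptotics.
Variable R : realType.

Let rt (n : nat) : nat := Nat.sqrt n.+1.

Let rt_spec n : (rt n * rt n <= n.+1)%N /\ (n.+1 < (rt n).+1 * (rt n).+1)%N.
Proof.
have [/ssrnat.leP a /ssrnat.ltP b] := PeanoNat.Nat.sqrt_spec n.+1 (PeanoNat.Nat.le_0_l _).
by split.
Qed.

Let rt_cvg : rt n @[n --> \oo] --> \oo.
Proof.
apply/cvgnyPge => A; exists (A * A)%N => // n /= An.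
by have [_] := rt_spec n; nia.
Qed.

Lemma cvg_sqr_geometric (y : R) : 0 <= y -> y < 1 ->
  (fun s : nat => (s.+1 ^ 2)%:R * y ^+ s) @ \oo --> (0 : R).
Proof.
move=> y0 y1; pose r := Num.sqrt (Num.sqrt y).
have r0 : 0 <= r by exact: sqrtr_ge0.
have r4 : r ^+ 4 = y by rewrite -[4%N]/(2 * 2)%N exprM !sqr_sqrtr ?sqrtr_ge0.
have r1 : r < 1 by rewrite -(@expr_lt1 _ 4) // r4.
(* With [r] the fourth root of [y], each of the two factors [s.+1] absorbs one [r ^+ s] through the
   geometric series, leaving [(r ^+ 2) ^+ s] to decay. *)
have B s : s.+1%:R * r ^+ s <= (1 - r)^-1.
  rewrite -[leRHS]mul1r ler_pdivlMr ?subr_gt0 //.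
  apply: le_trans (_ : (\sum_(i < s.+1) r ^+ i) * (1 - r) <= _).
    have nr0 : 0 <= 1 - r by rewrite subr_ge0 ltW.
    rewrite ler_wpM2r //.
    have -> : s.+1%:R * r ^+ s = \sum_(i < s.+1) r ^+ s.
      by rewrite sumr_const card_ord mulr_natl.
    by apply: ler_sum => i _; rewrite ler_wiXn2l ?(ltW r1) ?leq_ord.
  rewrite mulrC -opprB mulNr -subrX1 opprB lerBlDr lerDl.
  by rewrite exprn_ge0.
apply: (@squeeze_cvgr _ _ _ _ (fun=> 0) (fun s => (1 - r) ^- 2 * (r ^+ 2) ^+ s)).
- apply: nearW => s; rewrite mulr_ge0 ?ler0n ?exprn_ge0 //=.
  have -> : y ^+ s = (r ^+ s) ^+ 2 * (r ^+ 2) ^+ s.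
    by rewrite -[LHS]/(y ^+ s) -{1}r4 -!exprM -exprD; congr (_ ^+ _); lia.
  rewrite mulrA natrX -exprMn.
  rewrite ler_wpM2r ?exprn_ge0 // -exprVn lerXn2r ?nnegrE //.
  + by rewrite mulr_ge0 ?exprn_ge0.
  + by rewrite invr_ge0 subr_ge0 ltW.
- exact: cvg_cst.
- apply: cvg_geometric; rewrite ger0_norm ?exprn_ge0 //.
  by rewrite expr_lt1.
Qed.

Lemma cvg_natM_exp_sqrt (y : R) : 0 <= y -> y < 1 ->
  (fun n => n.+1%:R * y ^+ Nat.sqrt n.+1) @ \oo --> (0 : R).
Proof.
move=> y0 y1.
apply: (@squeeze_cvgr _ _ _ _ (fun=> 0) (fun n => ((rt n).+1 ^ 2)%:R * y ^+ rt n)).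
- apply: nearW => n; rewrite mulr_ge0 ?ler0n ?exprn_ge0 //=.
  rewrite ler_wpM2r ?exprn_ge0 // ler_nat.
  by have [_] := rt_spec n; rewrite -mulnn; exact: ltnW.
- exact: cvg_cst.
- exact: (cvg_comp _ _ rt_cvg (cvg_sqr_geometric y0 y1)).
Qed.

(** With [s] the integer square root of [N], [s^2 <= N < (s+1)^2] bounds the term by the [s]-th
    power of [(s+1)^2 y^s]. This base tends to 0, and once below 1 it dominates its own powers. *)
Lemma cvg_exp_sqrtM_exp (y : R) : 0 <= y -> y < 1 ->
  (fun n => n.+1%:R ^+ Nat.sqrt n.+1 * y ^+ n.+1) @ \oo --> (0 : R).
Proof.
move=> y0 y1.
have C : (fun n => ((rt n).+1 ^ 2)%:R * y ^+ rt n) @ \oo --> (0 : R).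
  exact: (cvg_comp _ _ rt_cvg (cvg_sqr_geometric y0 y1)).
apply: (@squeeze_cvgr _ _ _ _ (fun=> 0) (fun n => ((rt n).+1 ^ 2)%:R * y ^+ rt n)) => //; last exact: cvg_cst.
have : \forall n \near \oo, ((rt n).+1 ^ 2)%:R * y ^+ rt n < 1.
  by apply: (cvgr_lt _ C); exact: ltr01.
apply: filterS => n lt1.
have [h1 h2] := rt_spec n; set s := rt n in lt1 h1 h2 *.
rewrite mulr_ge0 ?ler0n ?exprn_ge0 //=.
apply: le_trans (_ : (((s.+1) ^ 2)%:R * y ^+ s) ^+ s <= _).
  rewrite exprMn -[(y ^+ s) ^+ s]exprM ler_pM ?exprn_ge0 ?ler0n //.
    by rewrite lerXn2r ?nnegrE ?ler0n // ler_nat -mulnn ltnW.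
  by rewrite ler_wiXn2l ?(ltW y1) //.
have s0 : (0 < s)%N by move: h2; case: (s) => //.
rewrite -[leRHS]expr1 ler_wiXn2l ?(ltW lt1) // mulr_ge0 ?ler0n ?exprn_ge0 //.
Qed.

Lemma bernoulli_upper (x : R) n : 0 <= x -> n%:R * x <= 1 / 2 ->
  (1 + x) ^+ n <= 1 + 2 * (n%:R * x).
Proof.
move=> x0 nx.
have : (1 + x) ^+ n * (1 - n%:R * x) <= 1.
  elim: n nx => [|n IH] nx; first by rewrite expr0 mul0r subr0 mulr1.
  have nx' : n%:R * x <= 1 / 2.
    by apply: le_trans nx; rewrite ler_wpM2r // ler_nat.
  apply: le_trans (IH nx'); rewrite exprSr -mulrA ler_wpM2l ?exprn_ge0 ?addr_ge0 //.
  rewrite -natr1; have := ler0n R n; move: (n%:R) => k k0.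
  by have := mulr_ge0 (mulr_ge0 k0 x0) x0; have := mulr_ge0 x0 x0; lra.
have : 0 <= n%:R * x by rewrite mulr_ge0 ?ler0n.
have : 0 <= (1 + x) ^+ n by rewrite exprn_ge0 ?addr_ge0.
move: nx; move: (n%:R * x) ((1 + x) ^+ n) => a b a1 b0 a0 H.
(* For [a <= 1/2] one has [(1 + 2a)(1 - a) = 1 + a(1 - 2a) >= 1], so [b (1 - a) <= 1] yields
   [b <= 1 + 2a]. *)
have : 0 <= b * (a * (1 - 2 * a)) by rewrite !mulr_ge0 //; lra.
have : (1 + 2 * a) * (b * (1 - a)) <= (1 + 2 * a) * 1 by rewrite ler_wpM2l //; lra.
lra.
Qed.

Variable q : R.
Hypotheses (q0 : 0 <= q) (q1 : q < 1).

Lemma cvg_supc : (fun n => supc q n.+1 (Nat.sqrt n.+1)) @ \oo --> (1 : R).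
Proof.
rewrite /supc.
have y0 : 0 <= (1 + q) / 2 by move: q0; lra.
have y1 : (1 + q) / 2 < 1 by move: q1; lra.
have C1 := cvg_exp_sqrtM_exp y0 y1.
have C2 := cvg_natM_exp_sqrt q0 q1.
have C3 : (fun n => (1 + q ^+ Nat.sqrt n.+1) ^+ n.+1 - 1) @ \oo --> (0 : R).
  apply: (@squeeze_cvgr _ _ _ _ (fun=> 0) (fun n => 2 * (n.+1%:R * q ^+ Nat.sqrt n.+1))); last 2 first.
  - exact: cvg_cst.
  - by rewrite -[0](mulr0 2); exact: (cvgM (cvg_cst _)).
  have : \forall n \near \oo, n.+1%:R * q ^+ Nat.sqrt n.+1 < 1 / 2.
    by apply: (cvgr_lt _ C2); lra.
  apply: filterS => n lt1.
  rewrite subr_ge0 exprn_ege1 ?lerDl ?exprn_ge0 //= lerBlDl.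
  by rewrite bernoulli_upper ?exprn_ge0 // ltW.
rewrite [X in _ --> X](_ : 1 = 1 + 2 * 0 + 2 * 0); last by ring.
by apply: cvgD; [apply: cvgD; [exact: cvg_cst|exact: (cvgM (cvg_cst _))]|exact: (cvgM (cvg_cst _))].
Qed.

(** Since [j < s] and [s^2 <= N], the gap [N - j] is at least [N / 2]; with [y] the square root of
    [q], this trades [q ^+ (k * (N - j))] for powers of [y ^+ N]. Both corrections in [supU] are
    then at most [2 * (1 / 4)]. *)
Lemma near_supU_head : \forall n \near \oo,
  forall j, (1 <= j < Nat.sqrt n.+1)%N -> supU q n.+1 (Nat.sqrt n.+1) j <= 2.
Proof.
pose y := Num.sqrt q.
have y0 : 0 <= y by exact: sqrtr_ge0.
have yq : y ^+ 2 = q by rewrite sqr_sqrtr.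
have y1 : y < 1 by rewrite -(@expr_lt1 _ 2) // yq.
have C1 : \forall n \near \oo, n.+1%:R ^+ Nat.sqrt n.+1 * y ^+ n.+1 < 1 / 4.
  by apply: (cvgr_lt _ (cvg_exp_sqrtM_exp y0 y1)); lra.
have C2 : \forall n \near \oo, n.+1%:R * y ^+ Nat.sqrt n.+1 < 1 / 8.
  by apply: (cvgr_lt _ (cvg_natM_exp_sqrt y0 y1)); lra.
near=> n => j /andP[j1 js].
have [h1 h2] := rt_spec n; rewrite -/(rt n) in js *.
have D1 : n.+1%:R ^+ rt n * y ^+ n.+1 < 1 / 4 by near: n.
have D2 : n.+1%:R * y ^+ rt n < 1 / 8 by near: n.
have s2 : (2 <= rt n)%N by lia.
move: h1 h2 js D1 D2 s2; set s := rt n => h1 h2 js D1 D2 s2.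
have E1 : \sum_(1 <= k < s) 'C(n.+1, k)%:R * q ^+ (k * (n.+1 - j)) <= 1 / 4.
  apply: le_trans (ltW D1).
  apply: le_trans (_ : \sum_(1 <= k < s) 'C(n.+1, k)%:R * y ^+ n.+1 <= _).
    rewrite !big_nat; apply: ler_sum => k /andP[k1 ks].
    by rewrite ler_wpM2l ?ler0n // -yq -exprM ler_wiXn2l ?(ltW y1) //; nia.
  rewrite -mulr_suml ler_wpM2r ?exprn_ge0 //.
  by rewrite -natr_sum -natrX ler_nat leq_sum_bin_exp //; nia.
have E2 : 2 ^+ n.+1 * q ^+ (s * (n.+1 - j)) <= 1 / 4.
  have y8 : y ^+ s <= 1 / 8.
    apply: le_trans (ltW D2); rewrite ler_peMl ?exprn_ge0 //.
    by rewrite ler1n.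
  apply: le_trans (_ : (2 * y ^+ s) ^+ n.+1 <= _).
    rewrite exprMn ler_wpM2l ?exprn_ge0 // -yq -!exprM ler_wiXn2l ?(ltW y1) //.
    by nia.
  apply: le_trans (_ : 2 * y ^+ s <= _); last by lra.
  rewrite -[leRHS]expr1 ler_wiXn2l // ?mulr_ge0 ?exprn_ge0 //.
  by lra.
by rewrite /supU; lra.
Unshelve. all: by end_near.
Qed.

End asymptotics.

(** * Law of the leader set *)

Definition rows {T : Type} {n : nat} (xi : nat -> 'I_n.+1 -> 'I_n.+1 -> T -> bool)
    (s : nat) (w : T) : bmat n := [ffun i => [ffun j => xi s i j w]].

Fixpoint lead {T : Type} {n : nat} (xi : nat -> 'I_n.+1 -> 'I_n.+1 -> T -> bool)
    (t : nat) (w : T) : {set 'I_n.+1} :=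
  if t is t'.+1 then nextlead (lead xi t' w) (rows xi t' w) else [set: 'I_n.+1]%SET.

Definition stall {T : Type} {n : nat} (xi : nat -> 'I_n.+1 -> 'I_n.+1 -> T -> bool)
    (t : nat) (w : T) : bool := hit (lead xi t w) (rows xi t w) == finset.set0.

Lemma measure_fin_disjoint {d} {T : measurableType d} {R : realType}
    (P : {measure set T -> \bar R}) (I : finType) (D : pred I) (F : I -> set T) :
  (forall i, D i -> measurable (F i)) ->
  (forall i j w, F i w -> F j w -> i = j) ->
  measurable [set w | exists2 i, D i & F i w] /\
  P [set w | exists2 i, D i & F i w] = (\sum_(i | D i) P (F i))%E.
Proof.
move=> mF dF.
have fD : finite_set [set i | D i] by exact: finite_finset.
have -> : [set w | exists2 i, D i & F i w] = \bigcup_(i in [set i | D i]) F i by [].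
split; first exact: fin_bigcup_measurable.
rewrite measure_fin_bigcup //; first by rewrite (@bigfs _ _ _ _ (index_enum I) D) ?index_enum_uniq // => i; rewrite mem_index_enum.
by move=> i j _ _ [w []]; exact: dF.
Qed.

Section law.
Context {d : measure_display} {T : measurableType d} {R : realType}.
Variables (P : probability T R) (n : nat) (p : R).
Variable xi : nat -> 'I_n.+1 -> 'I_n.+1 -> T -> bool.
Hypothesis iid : bernoulli_iid P p xi.

Let cyl (S : seq (bidx n)) (b : bidx n -> bool) : set T :=
  [set w | forall k, k \in S -> xi k.1.1 k.1.2 k.2 w = b k].

Let measurable_cyl S b : measurable (cyl S b).
Proof.
elim: S => [|k S IH].
  by rewrite (_ : cyl _ _ = setT) //; apply/seteqP; split => // w _ k.
rewrite (_ : cyl _ _ = [set w | xi k.1.1 k.1.2 k.2 w = b k] `&` cyl S b).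
  apply: measurableI => //; have m := iid.1 k.1.1 k.1.2 k.2.
  case: (b k) => //; rewrite (_ : [set w | _] = ~` [set w | xi k.1.1 k.1.2 k.2 w]).
    exact: measurableC.
  by apply/seteqP; split => w /=; [move=> ->|move/negP/negbTE].
apply/seteqP; split => w /=.
  by move=> H; split=> [|k' k'S]; apply: H; rewrite inE ?eqxx ?k'S ?orbT.
by move=> [H1 H2] k'; rewrite inE => /predU1P[->|/H2].
Qed.

Let slice (t : nat) : seq (bidx n) :=
  [seq (t, ij.1, ij.2) | ij <- enum {: 'I_n.+1 * 'I_n.+1}].

Let mem_slice t k : (k \in slice t) = (k.1.1 == t).
Proof.
case: k => [[s i] j]; apply/mapP/eqP => [[ij _ [-> _ _]] //|/= ->].
by exists (i, j); rewrite ?mem_enum.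
Qed.

Let uniq_slice t : uniq (slice t).
Proof. by rewrite map_inj_uniq ?enum_uniq // => -[i j] [i' j'] [-> ->]. Qed.

Let prod_slice t (c : bmat n) :
  \prod_(k <- slice t) bwt p (c k.1.2 k.2) = mwt p c.
Proof. by rewrite big_map big_enum /= /mwt pair_bigA. Qed.

(* Prescribing variables of times [>= t] as well makes the induction on [t] go
   through: it carries the independence of the past and the future. *)
Lemma lead_cylinder t (A : {set 'I_n.+1}) (S : seq (bidx n)) (b : bidx n -> bool) :
  uniq S -> (forall k, k \in S -> (t <= k.1.1)%N) ->
  let E := [set w | lead xi t w = A /\
                    forall k, k \in S -> xi k.1.1 k.1.2 k.2 w = b k] in
  measurable E /\ P E = (leadlaw p t A * \prod_(k <- S) bwt p (b k))%:E.
Proof.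
elim: t A S b => [|t IH] A S b uS tS /=.
  have [->|nA] := eqVneq A [set: 'I_n.+1]%SET.
    rewrite (_ : [set w | _] = cyl S b); last by apply/seteqP; split => w; [case|].
    by split; [exact: measurable_cyl|rewrite iid.2 // mul1r].
  rewrite (_ : [set w | _] = set0); last first.
    by apply/seteqP; split => w //= [AT]; rewrite AT eqxx in nA.
  by split => //; rewrite measure0 mul0r.
(* The event is partitioned by the leader set [B] at time [t] and the full matrix [c] at time [t].
   Prescribing [c] enlarges [S] by [slice t], disjoint from [S], whose times are at least [t.+1]. *)
pose b' (c : bmat n) (k : bidx n) := if k.1.1 == t then c k.1.2 k.2 else b k.
pose F (Bc : {set 'I_n.+1} * bmat n) := [set w | lead xi t w = Bc.1 /\
  forall k, k \in slice t ++ S -> xi k.1.1 k.1.2 k.2 w = b' Bc.2 k].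
have nt k : k \in S -> (k.1.1 == t) = false by move=> /tS; case: eqP => // ->; rewrite ltnn.
have rowsE Bc w : F Bc w -> rows xi t w = Bc.2.
  move=> [_ H]; apply/ffunP => i; apply/ffunP => j; rewrite !ffunE.
  by have := H (t, i, j); rewrite mem_cat mem_slice eqxx /b' /= eqxx; exact.
have -> : [set w | nextlead (lead xi t w) (rows xi t w) = A /\
      forall k, k \in S -> xi k.1.1 k.1.2 k.2 w = b k]
    = [set w | exists2 Bc, nextlead Bc.1 Bc.2 == A & F Bc w].
  apply/seteqP; split => w /=.
    move=> [nA H]; exists (lead xi t w, rows xi t w) => /=; first exact/eqP.
    split => // k; rewrite mem_cat mem_slice /b' /=.
    by case: eqP => [<- _|_ /= /H //]; rewrite !ffunE.
  move=> [[B c] /eqP nA FBc]; rewrite (rowsE _ _ FBc); case: FBc => [-> H] /=; split => // k kS.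
  by have := H k; rewrite mem_cat kS orbT /b' nt //; exact.
have IHF Bc := IH Bc.1 (slice t ++ S) (b' Bc.2).
have {IHF} IHF Bc : measurable (F Bc) /\
    P (F Bc) = (leadlaw p t Bc.1 * mwt p Bc.2 * \prod_(k <- S) bwt p (b k))%:E.
  have [||mF ->] := IHF Bc.
  - rewrite cat_uniq uniq_slice uS andbT /=; apply/hasPn => k /nt.
    by rewrite mem_slice => ->.
  - by move=> k; rewrite mem_cat mem_slice => /orP[/eqP ->//|/tS /ltnW].
  split => //; rewrite big_cat /= -mulrA -(prod_slice t); congr (_ * (_ * _))%:E.
    by apply: eq_big_seq => k; rewrite mem_slice /b' => ->.
  by apply: eq_big_seq => k /nt; rewrite /b' => ->.
have [|Bc Bc' w H H'|mU ->] := @measure_fin_disjoint _ _ _ P _ (fun Bc => nextlead Bc.1 Bc.2 == A) F.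
- by move=> Bc _; exact: (IHF Bc).1.
- rewrite [Bc]surjective_pairing [Bc']surjective_pairing -(rowsE _ _ H) -(rowsE _ _ H').
  by case: H => <- _; case: H' => <- _.
split => //; rewrite (eq_bigr _ (fun Bc _ => (IHF Bc).2)) sumEFin; congr _%:E.
rewrite -mulr_suml; congr (_ * _).
by rewrite (pair_big_dep xpredT (fun B c => nextlead B c == A)).
Qed.

(** Given the leader set [B], a stall means that all [n.+1 * #|B|] entries in its columns vanish,
    again a cylinder event for [lead_cylinder]. *)
Lemma stall_prob t :
  measurable [set w | stall xi t w] /\
  P [set w | stall xi t w] = (leadpgf p n t n.+1)%:E.
Proof.
pose S (B : {set 'I_n.+1}) := [seq k <- slice t | k.2 \in B].
pose F B := [set w | lead xi t w = B /\
  forall k, k \in S B -> xi k.1.1 k.1.2 k.2 w = false].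
have -> : [set w | stall xi t w] = [set w | exists2 B, xpredT B & F B w].
  apply/seteqP; split => w /=.
    move=> st; exists (lead xi t w) => //; split => // k.
    rewrite mem_filter mem_slice => /andP[kB /eqP ->].
    have /eqP/setP/(_ k.1.2) := st; rewrite !inE => /negbT/existsPn/(_ k.2).
    by move: kB; rewrite !ffunE => ->; case: xi.
  move=> [B _ [LB H]]; rewrite /stall LB; apply/eqP/setP => i; rewrite !inE.
  apply/existsP => -[j /andP[jB]]; rewrite !ffunE.
  by have := H (t, i, j); rewrite mem_filter mem_slice jB eqxx /= => ->.
have FE B : measurable (F B) /\
    P (F B) = (leadlaw p t B * (1 - p) ^+ (n.+1 * #|B|))%:E.
  have [||mF ->] := @lead_cylinder t B (S B) (fun=> false).
  - by rewrite filter_uniq ?uniq_slice.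
  - by move=> k; rewrite mem_filter mem_slice => /andP[_ /eqP ->].
  split => //; congr (_ * _)%:E; rewrite big_filter big_map big_enum_cond /=.
  rewrite -(pair_big xpredT (fun j => j \in B) (fun _ _ => 1 - p)) /=.
  by rewrite !prodr_const card_ord -exprM mulnC.
have [|B B' w [<- _] [<- _] //|mU ->] := @measure_fin_disjoint _ _ _ P _ xpredT F.
  by move=> B _; exact: (FE B).1.
by split => //; rewrite (eq_bigr _ (fun B _ => (FE B).2)) sumEFin.
Qed.

End law.

(** * Stalls and the speed *)

Section maxI.
Context {R : realType} {n : nat}.
Implicit Types f g : 'I_n.+1 -> R.

Lemma maxI_ge f i : f i <= maxI f.
Proof. by rewrite /maxI; apply: le_bigmax. Qed.

Lemma maxI_le f a : (forall i, f i <= a) -> maxI f <= a.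
Proof. by move=> fa; rewrite /maxI; apply: bigmax_le. Qed.

End maxI.

Section leaders.
Context {T : Type} {R : realType} {n : nat}.
Variable xi : nat -> 'I_n.+1 -> 'I_n.+1 -> T -> bool.

(** The dynamics are monotone and commute with adding constants; this removes the dependence of the
    speed on the initial data. *)
Lemma proc_shift (X Y : 'I_n.+1 -> R) (a : R) t w i :
  (forall j, X j <= Y j + a) -> proc X xi t w i <= proc Y xi t w i + a.
Proof.
move=> XY; elim: t i => [|t IH] i //=.
apply: maxI_le => j; apply: le_trans (lerD (IH j) (lexx _)) _.
by rewrite addrAC lerD2r (maxI_ge (fun j => proc Y xi t w j + (xi t i j w)%:R)).
Qed.

Lemma lead_nonempty t w : exists l, l \in lead xi t w.
Proof.
case: t => [|t] /=; first by exists ord0; rewrite inE.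
by rewrite /nextlead; case: eqVneq => [_|/finset.set0Pn //]; exists ord0; rewrite inE.
Qed.

(* A stall makes every site a leader: leaders are kept at the maximum and the
   other sites, being at least one step behind, can only catch up. *)
Lemma proc_lead t w i :
  let M := (\sum_(s < t) ~~ stall xi s w)%N%:R : R in
  proc (fun=> 0) xi t w i <= M - (i \notin lead xi t w)%:R
  /\ (i \in lead xi t w -> proc (fun=> 0) xi t w i = M).
Proof.
elim: t i => [|t IH] i /=; first by rewrite big_ord0 inE subr0.
set M := (\sum_(s < t) _)%N%:R in IH; set X := proc _ xi t w in IH.
rewrite big_ord_recr /= natrD -/M.
(* A site that does not lead is at most [M - 1], so even with a one it offers no more than [M]. *)
have leM j : X j + (xi t i j w)%:R <=
    M + (xi t i j w && (j \in lead xi t w))%:R.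
  have [H _] := IH j; case: (j \in lead xi t w) H; case: (xi t i j w) => /=; lra.
have [l lead_l] := lead_nonempty t w.
have hitE : (i \in hit (lead xi t w) (rows xi t w)) =
    [exists j in lead xi t w, xi t i j w].
  by rewrite inE; apply: eq_existsb => j; rewrite !ffunE.
have geM : M <= maxI (fun j => X j + (xi t i j w)%:R).
  by apply: le_trans (maxI_ge _ l); rewrite /= (IH l).2 // lerDl ler0n.
have [ih|ih] := boolP (i \in hit (lead xi t w) (rows xi t w)).
  have nst : stall xi t w = false.
    by rewrite /stall; apply/negbTE; apply/finset.set0Pn; exists i.
  rewrite /nextlead -/(stall xi t w) nst ih /= subr0.
  have le1 : maxI (fun j => X j + (xi t i j w)%:R) <= M + 1.
    by apply: maxI_le => j; apply: le_trans (leM j) _; rewrite lerD2l lern1 leq_b1.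
  split => // _; apply/eqP; rewrite eq_le le1 /=.
  move: ih; rewrite hitE => /exists_inP[j jl xij].
  by have := maxI_ge (fun j => X j + (xi t i j w)%:R) j; rewrite (IH j).2 // xij.
have le0 : maxI (fun j => X j + (xi t i j w)%:R) <= M.
  apply: maxI_le => j; apply: le_trans (leM j) _.
  have -> : xi t i j w && (j \in lead xi t w) = false; last by rewrite addr0.
  apply: contraNF ih => /andP[xij jl]; rewrite hitE; apply/exists_inP; by exists j.
rewrite /nextlead -/(stall xi t w); case: ifP => /= st.
  by rewrite inE /= subr0 addr0; split => // _; apply/eqP; rewrite eq_le le0.
(* Some other site was hit: the maximum rises to [M + 1], while site [i] stays at most [M] and stops
   leading. *)
by rewrite (negbTE ih) /=; split; [lra|].
Qed.

Lemma maxI_proc t w :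
  maxI (proc (fun=> 0 : R) xi t w) = (\sum_(s < t) ~~ stall xi s w)%N%:R.
Proof.
apply/eqP; rewrite eq_le; apply/andP; split.
  apply: maxI_le => i; apply: le_trans (proc_lead t w i).1 _.
  by rewrite gerBl ler0n.
have [l ll] := lead_nonempty t w.
by rewrite -((proc_lead t w l).2 ll); exact: maxI_ge.
Qed.

(** The initial data move the maximum by at most [a], hence the average by [a / t]; from zero data
    the maximum counts the steps without a stall. *)
Lemma cvg_stall_freq (X0 : 'I_n.+1 -> R) (v : R) w :
  (fun t : nat => t%:R^-1 * maxI (proc X0 xi t w)) @ \oo --> v ->
  (fun t : nat => t%:R^-1 * \sum_(s < t) (stall xi s w)%:R) @ \oo --> 1 - v.
Proof.
move=> Hv; pose a := maxI (fun i => `|X0 i|).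
have aX i : `|X0 i| <= a by exact: (maxI_ge (fun i => `|X0 i|)).
have dist t : `|maxI (proc X0 xi t w) - maxI (proc (fun=> 0 : R) xi t w)| <= a.
  rewrite ler_norml lerBlDl lerBrDl; apply/andP; split; last first.
    apply: maxI_le => i; apply: le_trans (proc_shift (Y := fun=> 0) t w i (a := a) _) _.
      by move=> j; rewrite add0r (le_trans (ler_norm _)).
    by rewrite lerD2r; exact: maxI_ge.
  rewrite lerBlDr.
  apply: maxI_le => i; apply: le_trans (proc_shift (Y := X0) t w i (a := a) _) _.
    by move=> j; rewrite -lerBlDl sub0r (le_trans (ler_norm _)) // normrN.
  by rewrite lerD2r; exact: maxI_ge.
have inv0 : (fun t : nat => (t%:R : R)^-1) @ \oo --> (0 : R).
  apply/gtr0_cvgV0; last exact: cvgr_idn.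
  by exists 1%N => // t /= t1; rewrite ltr0n.
have d0 : (fun t : nat => t%:R^-1 *
    (maxI (proc X0 xi t w) - maxI (proc (fun=> 0 : R) xi t w))) @ \oo --> (0 : R).
  apply: norm_cvg0; apply: (@squeeze_cvgr _ _ _ _ (fun=> 0) (fun t => t%:R^-1 * a)).
  - apply: nearW => t; rewrite normr_ge0 normrM ger0_norm ?invr_ge0 ?ler0n //=.
    by rewrite ler_wpM2l ?invr_ge0 ?ler0n.
  - exact: cvg_cst.
  - by rewrite -[0](mul0r a); exact: (cvgM inv0 (cvg_cst _)).
have C : (fun t : nat => 1 - (t%:R^-1 * maxI (proc X0 xi t w) - t%:R^-1 *
    (maxI (proc X0 xi t w) - maxI (proc (fun=> 0 : R) xi t w)))) @ \oo --> 1 - (v - 0).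
  by apply: cvgB; [exact: cvg_cst|exact: cvgB].
rewrite subr0 in C; apply: cvg_trans C; apply: near_eq_cvg.
(* The identity needs [t >= 1]: at [t = 0] the convention [0^-1 = 0] breaks it. *)
exists 1%N => // t /= t1; rewrite -mulrBr subKr maxI_proc.
have t0 : t%:R != 0 :> R by rewrite pnatr_eq0 -lt0n.
rewrite -[X in X - _](mulVf t0) -mulrBr; congr (_ * _).
rewrite natr_sum -[X in X%:R - _](card_ord t) -sum1_card natr_sum -sumrB.
by apply: eq_bigr => s _; case: stall; rewrite /= ?subrr ?subr0.
Qed.

End leaders.

(** * From almost sure to expected stall frequency *)

Section mean.
Context {d : measure_display} {T : measurableType d} {R : realType}.
Variables (P : probability T R) (n : nat) (p : R).
Variable xi : nat -> 'I_n.+1 -> 'I_n.+1 -> T -> bool.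
Hypothesis iid : bernoulli_iid P p xi.

(** Stall frequencies lie in [[0, 1]], so dominated convergence carries the almost sure limit to
    their means. *)
Lemma cvg_mean_stall (X0 : 'I_n.+1 -> R) (v : R) :
  {ae P, forall w, (fun t : nat => t%:R^-1 * maxI (proc X0 xi t w)) @ \oo --> v} ->
  (fun t : nat => t%:R^-1 * \sum_(s < t) leadpgf p n s n.+1) @ \oo --> 1 - v.
Proof.
move=> Hv.
pose f t w : R := t%:R^-1 * \sum_(s < t) (stall xi s w)%:R.
have stallE s w : (stall xi s w)%:R = \1_[set w | stall xi s w] w :> R.
  by rewrite indicE; congr (_%:R); congr nat_of_bool; apply/idP/idP; rewrite inE.
have mst s : measurable_fun setT (fun w => (stall xi s w)%:R : R).
  under eq_fun => w do rewrite stallE.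
  by apply/measurable_indicP; exact: (stall_prob iid s).1.
have mf t : measurable_fun setT (EFin \o f t).
  apply/measurable_EFinP; apply: measurable_funM; first exact: measurable_cst.
  exact: measurable_sum.
have intf t : (\int[P]_(w in setT) (f t w)%:E =
    (t%:R^-1 * \sum_(s < t) leadpgf p n s n.+1)%:E)%E.
  rewrite /f; under eq_integral => w _ do rewrite EFinM -sumEFin.
  rewrite ge0_integralZl_EFin //; last first.
  - apply: emeasurable_sum => s; exact/measurable_EFinP.
  - by move=> w _; apply: sume_ge0 => s _; rewrite lee_fin ler0n.
  rewrite ge0_integral_sum //; last by move=> s; exact/measurable_EFinP.
  rewrite EFinM -sumEFin; congr (_ * _)%E; apply: eq_bigr => s _.
  under eq_integral => w _ do rewrite stallE.
  have [mS PS] := stall_prob iid s.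
  by rewrite integral_indic // setIT; exact: PS.
have [|||_ _] := @dominated_convergence _ _ _ P setT measurableT
    (fun t => EFin \o f t) (cst (1 - v)%:E) (cst 1%:E) mf (measurable_cst _).
- apply: filterS Hv => w Hw _; apply/cvg_EFin; first exact: nearW.
  exact: cvg_stall_freq Hw.
- exact: finite_measure_integrable_cst.
- apply: aeW => w t _ /=; rewrite lee_fin ger0_norm; last first.
    by rewrite mulr_ge0 ?invr_ge0 ?ler0n // sumr_ge0.
  have [->|t0] := posnP t; first by rewrite /f big_ord0 mulr0.
  rewrite /f mulrC ler_pdivrMr ?ltr0n // mul1r -[X in _ <= X%:R](card_ord t) -sum1_card natr_sum.
  by apply: ler_sum => s _; rewrite ler_nat leq_b1.
have -> : (\int[P]_(x in setT) cst (1 - v)%:E x = (1 - v)%:E)%E.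
  by rewrite integral_cst //; have := @probability_setT _ _ _ P => /= ->; rewrite mule1.
rewrite (_ : [sequence _]_t = EFin \o (fun t : nat => t%:R^-1 * \sum_(s < t) leadpgf p n s n.+1)).
  by move/fine_cvgP => [].
by apply/funext => t; exact: intf.
Qed.

End mean.

(** * Bounds on Cesaro limits and the final squeeze *)

Section cesaro.
Variables (R : realType) (e : nat -> R) (c : R).
Hypothesis ec : (fun t : nat => t%:R^-1 * \sum_(s < t) e s) @ \oo --> c.

Lemma mean_limit_le u : (forall s, e s <= u) -> c <= u.
Proof.
move=> eu; apply: (ler_cvg_to ec (@cvg_cst _ u _ _ _)).
exists 1%N => // t /= t1; rewrite ler_pdivrMl ?ltr0n //.
rewrite mulr_natl -[X in _ *+ X](card_ord t) -sumr_const.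
exact: ler_sum.
Qed.

(** The one-step lower bound says nothing at time 0; dropping that term costs [l / (t + 1)], which
    vanishes. *)
Lemma mean_limit_ge l : 0 <= e 0 -> (forall s, l <= e s.+1) -> l <= c.
Proof.
move=> e0 le.
have C : (fun t : nat => l - harmonic t * l) @ \oo --> l - 0 * l.
  by apply: cvgB; [exact: cvg_cst|apply: cvgM; [exact: cvg_harmonic|exact: cvg_cst]].
rewrite mul0r subr0 in C.
apply: (ler_cvg_to C (cvg_comp _ _ (@cvg_addnr 1) ec)); apply: nearW => t /=.
rewrite addn1 /harmonic /= ler_pdivlMl ?ltr0n // mulrBr mulrA divff ?mul1r ?pnatr_eq0 //.
rewrite big_ord_recl -[t.+1%:R]natr1 mulrDl mul1r addrK ler_wpDl //.
rewrite mulr_natl -[X in _ *+ X](card_ord t) -sumr_const.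
by apply: ler_sum => s _; exact: le.
Qed.

End cesaro.

Lemma cvg_natM_exp (R : realType) (y : R) : 0 <= y -> y < 1 ->
  (fun n => n.+1%:R * y ^+ n.+1) @ \oo --> (0 : R).
Proof.
move=> y0 y1.
apply: (@squeeze_cvgr _ _ _ _ (fun=> 0) (fun n => (n.+1 ^ 2)%:R * y ^+ n)).
- apply: nearW => n; rewrite mulr_ge0 ?ler0n ?exprn_ge0 //=.
  rewrite ler_pM ?ler0n ?exprn_ge0 //; first by rewrite ler_nat -mulnn leq_pmulr.
  by rewrite exprS ler_piMl ?exprn_ge0 // ltW.
- exact: cvg_cst.
- exact: cvg_sqr_geometric.
Qed.

Unset Implicit Arguments.

(* N = n.+1; v n is the a.s. (deterministic) limit v_N. *)
Theorem theorem5p1 (R : realType) (p : R) (hp0 : 0 < p) (hp1 : p < 1)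
  (d : measure_display) (T : nat -> measurableType d)
  (P : forall n, probability (T n) R)
  (xi : forall n, nat -> 'I_n.+1 -> 'I_n.+1 -> T n -> bool)
  (X0 : forall n, 'I_n.+1 -> R) (v : nat -> R) :
  (forall n, bernoulli_iid (P n) p (xi n)) ->
  (forall n, {ae P n, forall w,
     (fun t : nat => (t%:R)^-1 * maxI (proc (X0 n) (xi n) t w)) @ \oo --> v n}) ->
  (fun n : nat =>
     (v n - (1 - (1 - p) ^+ (n.+1 ^ 2) * 2 ^+ n.+1))
       / ((1 - p) ^+ (n.+1 ^ 2) * 2 ^+ n.+1)) @ \oo --> (0 : R).
Proof.
move=> iid lim.
pose q := 1 - p; have q0 : 0 < q by rewrite subr_gt0.
have q1 : q < 1 by rewrite /q; lra.
have mean n := cvg_mean_stall (iid n) (lim n).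
pose D n : R := q ^+ (n.+1 ^ 2) * 2 ^+ n.+1.
have D0 n : 0 < D n by rewrite mulr_gt0 ?exprn_gt0.
have half1 : (2^-1 : R) < 1 by lra.
have half0 : 0 <= (2^-1 : R) by lra.
have Cq := cvg_natM_exp (ltW q0) q1; have C2 := cvg_natM_exp half0 half1.
(* The first factor bounds [(1 - q^N)^N] below by Bernoulli's inequality; the second bounds
   [(2^N - N - 1) / 2^N] below, using [N + 1 <= 2 N]. *)
pose h n : R := (1 - n.+1%:R * q ^+ n.+1) * (1 - 2 * (n.+1%:R * 2^-1 ^+ n.+1)).
have upper : \forall n \near \oo, 1 - v n <= D n * supc q n.+1 (Nat.sqrt n.+1).
  have sc2 : \forall n \near \oo, supc q n.+1 (Nat.sqrt n.+1) < 2.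
    by apply: (cvgr_lt _ (cvg_supc (ltW q0) q1)); lra.
  apply: filterS3 (near_supU_head (ltW q0) q1) sc2 (nbhs_infty_gt 0) => n head2 c2 n0.
  apply: (@mean_limit_le _ (fun s => leadpgf p n s n.+1) _ (mean n)) => t.
  have [s0 sN] : (0 < Nat.sqrt n.+1)%N /\ (Nat.sqrt n.+1 <= n.+1)%N.
    have [/ssrnat.leP a /ssrnat.ltP b] := PeanoNat.Nat.sqrt_spec n.+1 (PeanoNat.Nat.le_0_l _).
    by split; nia.
  rewrite /D -mulrA -mulnn.
  apply: (@supersolution_bound _ q n.+1 (Nat.sqrt n.+1) (ltW q0) (ltW q1) s0 sN n0 head2
    (ltW c2) (leadpgf p n)) => [u|i|u i].
  - by rewrite /leadpgf -[RHS](leadE_cst p n u); apply: eq_bigr => A _; rewrite mul0n expr0.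
  - by rewrite /leadpgf leadE0 cardsT card_ord.
  - exact: (leadpgfS_le (ltW hp0) (ltW hp1)).
have lower : \forall n \near \oo, D n * h n <= 1 - v n.
  have Cp : \forall n \near \oo, n.+1%:R * q ^+ n.+1 < p by exact: (cvgr_lt _ Cq).
  have Ch : \forall n \near \oo, n.+1%:R * 2^-1 ^+ n.+1 < 1 / 2 :> R.
    by apply: (cvgr_lt _ C2); lra.
  apply: filterS2 Cp Ch => n nxp n2; apply: (@mean_limit_ge _ (fun s => leadpgf p n s n.+1) _ (mean n)) => [|t].
    by rewrite /leadpgf leadE0; apply: exprn_ge0; exact: ltW.
  have x0 : 0 <= q ^+ n.+1 by apply: exprn_ge0; exact: ltW.
  have x1 : q ^+ n.+1 <= 1 by apply: exprn_ile1; exact: ltW.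
  (* From [N q^N < p] and Bernoulli's inequality. *)
  have hx : 1 - p <= (1 - q ^+ n.+1) ^+ n.
    apply: le_trans (bernoulli_lower n x0 x1).
    rewrite lerD2l lerN2 (le_trans _ (ltW nxp)) // ler_wpM2r // ler_nat.
    exact: leqnSn.
  apply: le_trans (leadpgfSS_ge (ltW hp0) (ltW hp1) t hx).
  have -> : D n * h n = (q ^+ n.+1) ^+ n.+1 *
      ((1 - n.+1%:R * q ^+ n.+1) * (2 ^+ n.+1 * (1 - 2 * (n.+1%:R * 2^-1 ^+ n.+1)))).
    by rewrite /D /h -mulnn exprM -!mulrA; congr (_ * _); rewrite mulrCA.
  rewrite -mulrA ler_wpM2l ?exprn_ge0 ?(ltW q0) //; apply: ler_pM.
  + by rewrite subr_ge0 (le_trans (ltW nxp)) // ltW.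
  + by rewrite mulr_ge0 ?exprn_ge0 //; move: n2; lra.
  + exact: bernoulli_lower.
  + rewrite mulrBr mulr1 lerD2l lerN2 mulrCA [2 ^+ _ * _]mulrCA -exprMn divff // expr1n mulr1.
    by rewrite -natrM ler_nat; lia.
have hc : (h @ \oo --> (1 : R)).
  rewrite [X in _ --> X](_ : 1 = (1 - 0) * (1 - 2 * 0)); last by ring.
  apply: cvgM; apply: cvgB; [exact: cvg_cst|exact: Cq|exact: cvg_cst|].
  by apply: cvgM; [exact: cvg_cst|exact: C2].
(* The normalised error equals [1 - (1 - v n) / D n], so the two bounds on [1 - v n] enclose it. *)
apply: (@squeeze_cvgr _ _ _ _ (fun n => 1 - supc q n.+1 (Nat.sqrt n.+1)) (fun n => 1 - h n)).
- apply: filterS2 upper lower => n U L; rewrite -/q -/(D n).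
  rewrite ler_pdivlMr // ler_pdivrMr // [X in X <= _ <= _]mulrC [X in _ <= _ <= X]mulrC.
  by rewrite !mulrBr !mulr1; apply/andP; split; lra.
- by rewrite -[0](subrr 1); apply: cvgB; [exact: cvg_cst|exact: (cvg_supc (ltW q0) q1)].
- by rewrite -[0](subrr 1); apply: cvgB; [exact: cvg_cst|exact: hc].
Qed.
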